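(* Let $n\ge3$ and let $\lambda\vdash n$ be a two-row partition. Then the weight function $m$ of the $\mathcal S_n$-graph $\Gamma_\lambda=(\mathrm{SYT}(\lambda),m,\mathrm{des})$ is given as follows, for $s,t\in\mathrm{SYT}(\lambda)$. 1) (Move of the first kind) $m(s\triangleright t)=1$ if $t$ is obtained from $s$ by interchanging $i\in s^1$ and $i+1\in s^2$ for some $1\le i\le n-1$. 2) (Move of the second kind) $m(s\triangleright t)=1$ if $t$ is obtained from $s$ by interchanging $i\in s^2$ and $j\in s^1$, where the following conditions hold: (a) $1<i<j\le n$ and $j-i$ is odd; (b) $i+1\in s^1$ and $j-1\in s^2$; (c) either $i-1\in s^1$ or $j+1\in s^2$ (if $j=n$, then $j+1\notin s^2$ by convention); (d) $\#\{\alpha\in s^2\mid\alpha\in[j-1-2k,j-2]\}\ge k$ for all $k\in[1,\frac{j-i-3}{2}]$; (e) $\#\{\alpha\in s^2\mid\alpha\in[i+2,j-2]\}=\frac{j-i-3}{2}$ when $j\ne i+1$. 3) Otherwise, $m(s\triangleright t)=0$.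
   Context: **Conventions.** $[a,b]=\{x\in\mathbb Z\mid a\le x\le b\}$; for $k\in\mathbb Z$, $\overline k$ is the element of $\{1,\dots,n\}$ congruent to $k$ mod $n$. For $a,b\in\{1,\dots,n\}$, $\langle a,b\rangle$ is $\emptyset$ if $a=\overline{b+1}$, else the cyclic interval $\{a,\overline{a+1},\dots,b\}$. $\mathrm{RSYT}(\lambda)$ (resp. $\mathrm{SYT}(\lambda)$) is the set of row-standard (resp. standard) Young tableaux of shape $\lambda=(\lambda_1,\lambda_2)$, $\lambda_1\ge\lambda_2\ge1$ (English convention), with entries $1,\dots,n$ each used once; $T^1$ (top), $T^2$ are the rows of $T$ as sets; interchanging entries is followed by re-sorting rows. $\overline{\mathrm{des}}(T)=\{i\in[1,n]\mid i$ lies in a strictly higher row than $\overline{i+1}\}$ and $\mathrm{des}(T)=\overline{\mathrm{des}}(T)-\{n\}$. **Labeled graphs.** An $I$-labeled graph is a triple $(V,m,\tau)$, $m:V\times V\to\mathbb Z[q^{\pm1/2}]$ (written $m(u\triangleright v)$), $\tau:V\to\{\text{subsets of }I\}$. Its parabolic restriction to $J\subset I$, written $\Gamma\!\downarrow_J$, has the same vertices, $\tau'(v)=\tau(v)\cap J$, and $m'(u\triangleright v)=m(u\triangleright v)$ if $\tau'(u)\not\subset\tau'(v)$ and $0$ otherwise. A full subgraph is obtained by restricting $m,\tau$ to a subset of vertices. **The graph $\Gamma_\lambda$.** Up to isomorphism, $\Gamma_\lambda$ is the Kazhdan–Lusztig $W$-graph of $\mathcal S_n$ (in reduced form, i.e.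 with $m(u\triangleright v)$ set to $0$ whenever $\tau(u)\subset\tau(v)$) attached to a left cell whose elements have Robinson–Schensted shape $\lambda$; here $\tau(w)$ is the left descent set and, for $\tau(u)\not\subset\tau(v)$, $m(u\triangleright v)$ is the symmetric Kazhdan–Lusztig coefficient $\mu(u,v)=\mu(v,u)$. It is identified with the full subgraph of $\overline\Gamma_\lambda\!\downarrow_{[1,n-1]}$ with vertex set $\mathrm{SYT}(\lambda)$, to which it is isomorphic; under this identification $\tau=\mathrm{des}$. **The graph $\overline\Gamma_\lambda$.** The $[1,n]$-labeled graph $(\mathrm{RSYT}(\lambda),m,\overline{\mathrm{des}})$ with $m\in\{0,1\}$ and $m(s\triangleright t)=1$ iff: (first kind) $t$ is obtained from $s$ by interchanging $\overline i\in s^1$ and $\overline{i+1}\in s^2$; or (second kind) $t$ is obtained from $s$ by interchanging $\overline i\in s^2$ and $\overline j\in s^1$, $\overline i\ne\overline{j+1}$, where $\overline{j-i}$ is odd; $\overline{i+1}\in s^1$ and $\overline{j-1}\in s^2$; $\overline{i-1}\in s^1$ or $\overline{j+1}\in s^2$; $\#(s^2\cap\langle\overline{j-1-2k},\overline{j-2}\rangle)\ge k$ for $k\in\{1,\dots,\frac{\overline{j-i}-3}2\}$; and $\#(s^2\cap\langle\overline{i+2},\overline{j-2}\rangle)=\frac{\overline{j-i}-3}2$ when $\overline j\neq\overline{i+1}$. *)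

(* Defs.v *)
From HB Require Import structures.
From mathcomp Require Import all_boot all_order all_algebra all_fingroup.
From mathcomp Require Import boolp classical_sets.

Set Implicit Arguments.
Unset Strict Implicit.
Unset Printing Implicit Defensive.

Import GRing.Theory.
Local Open Scope ring_scope.
Local Open Scope classical_set_scope.

Notation "x %:F" := (@FracField.tofrac _ x) : ring_scope.

(* Z[q^(1/2), q^(-1/2)], where 'X stands for q^(1/2). *)
Definition is_laurent : {pred {fraction {poly int}}} :=
  fun f => `[< exists (p : {poly int}) (k : nat), f = p%:F / ('X^k)%:F >].

Lemma is_laurent_subring : subring_closed is_laurent.
Proof.
have Xn0 k : ('X^k : {poly int})%:F != 0.
  by rewrite tofrac_eq0 monic_neq0 ?monicXn.
split.
- apply/asboolP; exists 1, 0%N.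
  by rewrite expr0 tofrac1 divr1.
- move=> _ _ /asboolP[p [k ->]] /asboolP[r [l ->]]; apply/asboolP.
  exists (p * 'X^l - r * 'X^k), (k + l)%N.
  by rewrite -mulNr addf_div // exprD tofracB !tofracM mulNr.
- move=> _ _ /asboolP[p [k ->]] /asboolP[r [l ->]]; apply/asboolP.
  exists (p * r), (k + l)%N.
  by rewrite mulf_div exprD !tofracM.
Qed.

HB.instance Definition _ :=
  GRing.isSubringClosed.Build {fraction {poly int}} is_laurent
    is_laurent_subring.

Record laurent := Laurent {
  laurent_val :> {fraction {poly int}};
  laurentP : laurent_val \in is_laurent }.

HB.instance Definition _ := [isSub for laurent_val].
HB.instance Definition _ := [Choice of laurent by <:].
HB.instance Definition _ := [SubChoice_isSubComNzRing of laurent by <:].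

Record lgraph (I : set nat) := LGraph {
  vert : Type;
  wt : vert -> vert -> laurent;
  tau : vert -> set nat;
  tau_sub : forall v, tau v `<=` I }.

Section LabeledGraphs.
Variables (I : set nat) (G : lgraph I).

Definition restrict_tau (J : set nat) (v : vert G) : set nat := tau v `&` J.

Definition restrict_wt (J : set nat) (u v : vert G) : laurent :=
  if `[< restrict_tau J u `<=` restrict_tau J v >] then 0 else wt u v.

Definition parabolic_restriction (J : set nat) : lgraph J :=
  @LGraph J (vert G) (restrict_wt J) (restrict_tau J)
    (fun v i vi => vi.2).

Definition full_subgraph (P : pred (vert G)) : lgraph I :=
  @LGraph I {v : vert G | P v} (fun u v => wt (sval u) (sval v))
    (fun v => tau (sval v)) (fun v => @tau_sub I G (sval v)).

Definition lgraph_iso (G' : lgraph I) (phi : vert G -> vert G') : Prop :=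
  [/\ bijective phi,
      forall u v, wt (phi u) (phi v) = wt u v &
      forall v, tau (phi v) = tau v].

End LabeledGraphs.

Section Tableaux.
Variables n lam1 lam2 : nat.

Record rsyt := RSYT {
  toprow : seq nat;
  botrow : seq nat;
  rsytP : [&& size toprow == lam1, size botrow == lam2,
              sorted ltn toprow, sorted ltn botrow &
              perm_eq (toprow ++ botrow) (iota 1 n)] }.

Definition is_standard (T : rsyt) : bool :=
  [forall k : 'I_lam2, (nth 0 (toprow T) k < nth 0 (botrow T) k)%N].

Definition syt : Type := {T : rsyt | is_standard T}.

Definition interchanged (s t : rsyt) (a b : nat) : Prop :=
  [/\ a \in toprow s, b \in botrow s,
      toprow t = sort leq [seq if x == a then b else x | x <- toprow s] &
      botrow t = sort leq [seq if x == b then a else x | x <- botrow s]].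

(* The representative of k modulo n in {1, ..., n}. *)
Definition ov (k : int) : nat := `|((k - 1) %% n%:Z)%Z|%N.+1.

Definition cyc (a b : nat) : seq nat :=
  if a == ov (b%:Z + 1) then [::]
  else [seq ov (a%:Z + d%:Z)
       | d : nat <- iota 0 `|((b%:Z - a%:Z) %% n%:Z)%Z|%N.+1].

Definition desbar (T : rsyt) : set nat :=
  [set i : nat |
    [/\ (1 <= i <= n)%N, i \in toprow T & ov (i%:Z + 1) \in botrow T]].

Definition des (T : rsyt) : set nat := desbar T `\ n.

Definition bar_move1 (s t : rsyt) : Prop :=
  exists i : int, interchanged s t (ov i) (ov (i + 1)).

Definition bar_move2 (s t : rsyt) : Prop :=
  exists i j : int,
    let d := ov (j - i) in
    interchanged s t (ov j) (ov i) /\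
    [/\ ov i <> ov (j + 1) /\ odd d,
        ov (i + 1) \in toprow s /\ ov (j - 1) \in botrow s,
        ov (i - 1) \in toprow s \/ ov (j + 1) \in botrow s,
        forall k : nat, (1 <= k <= (d - 3)./2)%N ->
          (k <= count [in cyc (ov (j - 1 - 2 * k%:Z)) (ov (j - 2))]
                  (botrow s))%N &
        ov j <> ov (i + 1) ->
          count [in cyc (ov (i + 2)) (ov (j - 2))] (botrow s)
          = ((d - 3)./2)%N].

Definition bar_wt (s t : rsyt) : laurent :=
  if `[< bar_move1 s t \/ bar_move2 s t >] then 1 else 0.

Lemma desbar_sub T : desbar T `<=` [set i | (1 <= i <= n)%N].
Proof. by move=> i []. Qed.

Definition Gamma_bar : lgraph [set i | (1 <= i <= n)%N] :=
  @LGraph _ rsyt bar_wt desbar desbar_sub.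

Definition Gamma : lgraph [set i | (1 <= i <= n.-1)%N] :=
  @full_subgraph _ (parabolic_restriction Gamma_bar _) is_standard.

Definition move1 (s t : rsyt) : Prop :=
  exists2 i : nat, (1 <= i <= n.-1)%N & interchanged s t i i.+1.

Definition move2 (s t : rsyt) : Prop :=
  exists i j : nat,
    interchanged s t j i /\
    [/\ (1 < i < j)%N /\ (j <= n)%N /\ odd (j - i),
        i.+1 \in toprow s /\ j.-1 \in botrow s,
        i.-1 \in toprow s \/ j.+1 \in botrow s,
        forall k : nat, (1 <= k <= (j - i - 3)./2)%N ->
          (k <= count (fun a => j - 1 - 2 * k <= a <= j - 2)%N (botrow s))%N &
        j <> i.+1 ->
          count (fun a => i + 2 <= a <= j - 2)%N (botrow s)
          = ((j - i - 3)./2)%N].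

(* G is regarded as a graph on standard tableaux by means of phi. *)
Definition given_by_moves (I : set nat) (G : lgraph I) (phi : syt -> vert G)
    : Prop :=
  (forall s : syt, tau (phi s) = des (sval s)) /\
  (forall s t : syt,
    [/\ move1 (sval s) (sval t) -> wt (phi s) (phi t) = 1,
        move2 (sval s) (sval t) -> wt (phi s) (phi t) = 1 &
        ~ move1 (sval s) (sval t) -> ~ move2 (sval s) (sval t) ->
          wt (phi s) (phi t) = 0]).

End Tableaux.

(* In permutations, the letter i in {1, ..., n} is the element of 'I_n with
   value i.-1. *)

Section KazhdanLusztig.
Variable n : nat.

Definition len (w : 'S_n) : nat :=
  #|[set p : 'I_n * 'I_n | (p.1 < p.2)%N && (w p.2 < w p.1)%N]%SET|.

(* The transposition exchanging the letters i and i.+1, for 1 <= i < n. *)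
Definition simple (i : nat) : 'S_n :=
  if (insub i.-1, insub i) is (Some a, Some b) then tperm a b else 1%g.

(* The function x |-> s_i (w x): products of permutations are read from left
   to right in MathComp. *)
Definition lmul (i : nat) (w : 'S_n) : 'S_n := (w * simple i)%g.

Definition ldes (w : 'S_n) : set nat :=
  [set i : nat | (1 <= i <= n.-1)%N /\ (len (lmul i w) < len w)%N].

Definition bruhat : rel 'S_n :=
  connect (fun x y =>
    [exists a, exists b, y == (x * tperm a b)%g] && (len x < len y)%N).

(* R-polynomials and Kazhdan-Lusztig polynomials in the variable 'X = q, as
   in Bjorner and Brenti, Theorems 5.1.1 and 5.1.4 (with left instead of right
   multiplication in the recursion for R). *)
Definition is_R_family (R : 'S_n -> 'S_n -> {poly int}) : Prop :=
  [/\ forall x w, ~~ bruhat x w -> R x w = 0,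
      forall w, R w w = 1,
      forall x w i, ldes w i -> ldes x i ->
        R x w = R (lmul i x) (lmul i w) &
      forall x w i, ldes w i -> ~ ldes x i ->
        R x w = 'X * R (lmul i x) (lmul i w) + ('X - 1) * R x (lmul i w)].

(* The left-hand side of the last equation is q^d P_(x,w)(q^-1). *)
Definition is_KL_family (P : 'S_n -> 'S_n -> {poly int}) : Prop :=
  exists2 R, is_R_family R &
  [/\ forall x w, ~~ bruhat x w -> P x w = 0,
      forall w, P w w = 1,
      forall x w, bruhat x w -> x != w ->
        ((size (P x w)).*2 <= (len w - len x).+1)%N &
      forall x w, bruhat x w ->
        let d := (len w - len x)%N in
        \poly_(k < d.+1) (P x w)`_(d - k)
        = \sum_(y | bruhat x y && bruhat y w) R x y * P y w].

(* There is exactly one family satisfying is_KL_family. *)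
Definition KL_poly : 'S_n -> 'S_n -> {poly int} :=
  xget (fun _ _ => 0) [set P | is_KL_family P].

(* The coefficient of q^((l(w) - l(x) - 1) / 2) in P_(x,w). *)
Definition mu_le (x w : 'S_n) : int :=
  if bruhat x w && odd (len w - len x)
  then (KL_poly x w)`_((len w - len x).-1./2) else 0.

Definition mu (u v : 'S_n) : int := if bruhat u v then mu_le u v else mu_le v u.

Definition KL_wt (u v : 'S_n) : laurent :=
  if `[< ldes u `<=` ldes v >] then 0 else (mu u v)%:~R.

Lemma ldes_sub w : ldes w `<=` [set i | (1 <= i <= n.-1)%N].
Proof. by move=> i []. Qed.

Definition KL_graph : lgraph [set i | (1 <= i <= n.-1)%N] :=
  @LGraph _ 'S_n KL_wt ldes ldes_sub.

Definition left_le : rel 'S_n :=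
  connect (fun x y => `[< mu x y <> 0 /\ ~ (ldes x `<=` ldes y) >]).

Definition is_left_cell (C : {set 'S_n}) : Prop :=
  exists w, C = [set x | left_le x w && left_le w x]%SET.

Definition cell_graph (C : {set 'S_n}) : lgraph [set i | (1 <= i <= n.-1)%N] :=
  @full_subgraph _ KL_graph [in C].

End KazhdanLusztig.

Fixpoint row_insert (x : nat) (r : seq nat) : seq nat * option nat :=
  if r is y :: r' then
    if (x < y)%N then (x :: r', Some y)
    else let: (r'', b) := row_insert x r' in (y :: r'', b)
  else ([:: x], None).

Fixpoint rs_insert (T : seq (seq nat)) (x : nat) : seq (seq nat) :=
  if T is r :: T' then
    let: (r', b) := row_insert x r in
    r' :: (if b is Some y then rs_insert T' y else T')
  else [:: [:: x]].

Definition rs_tableau n (w : 'S_n) : seq (seq nat) :=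
  foldl rs_insert [::] [seq (w i).+1 | i <- enum 'I_n].

Definition rs_shape n (w : 'S_n) : seq nat := map size (rs_tableau w).

(* Main.v *)
Require Import Defs.
From mathcomp Require Import all_boot all_order all_algebra all_fingroup.
From mathcomp Require Import boolp classical_sets.
From mathcomp Require Import zify.

Import GRing.Theory.

(* Between standard tableaux the cyclic moves do not wrap around: this is the
   ballot condition (at most m/2 of the entries 1, ..., m lie in the bottom
   row). Both kinds of moves destroy a descent of the source, so the parabolic
   restriction erases no arrow. The statement on left cells is a transport
   along the given isomorphism. *)

(** * Residues modulo [n] and cyclic intervals *)

Lemma ov_mod (n : nat) (k l : int) : (k = l %[mod n])%Z -> ov n k = ov n l.
Proof. by move=> kl; rewrite /ov -modzDml kl modzDml. Qed.

Lemma ovK (n : nat) (k : int) : 0 < n -> ((ov n k)%:Z = k %[mod n])%Z.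
Proof.
move=> n_gt0; rewrite /ov intS gez0_abs ?modz_ge0 //; last by lia.
by rewrite modzDmr addrC subrK.
Qed.

Lemma ov_range n (k : int) : 0 < n -> 0 < ov n k <= n.
Proof. by move=> n_gt0; rewrite /ov; lia. Qed.

Lemma ov_small n (k : nat) : 0 < k <= n -> ov n k%:Z = k.
Proof. by move=> kn; rewrite /ov modz_small; lia. Qed.

Lemma ovDn (n : nat) (k : int) : ov n (n%:Z + k)%R = ov n k.
Proof. by apply: ov_mod; rewrite modzDl. Qed.

Lemma ov_succ n (k : nat) : 0 < k < n -> ov n (k%:Z + 1)%R = k.+1.
Proof. by move=> kn; rewrite -[(_ + _)%R]/(Posz (k + 1)) addn1 ov_small; lia. Qed.

(** Since [b < n], the successor [b + 1] is its own representative, so the empty case of [cyc] is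
    exactly [a = b + 1]; otherwise [a + d] never passes [n]. For [a = 1], [b = n] the definition
    would give the empty interval. *)
Lemma mem_cyc n (a b x : nat) : 0 < a <= b.+1 -> b < n ->
  (x \in cyc n a b) = (a <= x <= b).
Proof.
move=> ab bn; rewrite /cyc.
have -> : ov n (b%:Z + 1)%R = b.+1.
  by rewrite -[(_ + _)%R]/(Posz (b + 1)) addn1 ov_small; lia.
case: eqP => [|ab']; first by rewrite in_nil; lia.
rewrite modz_small; last by lia.
apply/mapP/idP => [[d]|axb].
  rewrite mem_iota => dP ->.
  by rewrite -[(_ + _)%R]/(Posz (a + d)) ov_small; lia.
exists (x - a); first by rewrite mem_iota; lia.
by rewrite -[(_ + _)%R]/(Posz (a + (x - a))) ov_small; lia.
Qed.

(** * Rows of a tableau and the ballot condition *)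

Lemma row_entries {n l1 l2} (s : rsyt n l1 l2) :
  {in toprow s ++ botrow s, forall x, 0 < x <= n}.
Proof.
case/and5P: (rsytP s) => _ _ _ _ sP x.
by rewrite (perm_mem sP) mem_iota; lia.
Qed.

Lemma toprow_range {n l1 l2} (s : rsyt n l1 l2) x : x \in toprow s -> 0 < x <= n.
Proof. by move=> xs; apply: (@row_entries _ _ _ s); rewrite mem_cat xs. Qed.

Lemma botrow_range {n l1 l2} (s : rsyt n l1 l2) x : x \in botrow s -> 0 < x <= n.
Proof. by move=> xs; apply: (@row_entries _ _ _ s); rewrite mem_cat xs orbT. Qed.

Lemma top_bot_disjoint {n l1 l2} (s : rsyt n l1 l2) x :
  x \in toprow s -> x \in botrow s -> False.
Proof.
case/and5P: (rsytP s) => _ _ _ _ /perm_uniq; rewrite iota_uniq cat_uniq.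
by case/and3P => _ /hasPn sP _ xt /sP; rewrite /= xt.
Qed.

Lemma botrow_uniq {n l1 l2} (s : rsyt n l1 l2) : uniq (botrow s).
Proof.
by case/and5P: (rsytP s) => _ _ _ /(sorted_uniq ltn_trans ltnn).
Qed.

(** In an increasing row the entries at most [m] form an initial segment. This turns the columnwise
    definition of standardness into counts. *)
Lemma count_leq_sorted (r : seq nat) k m : sorted ltn r -> k < size r ->
  (nth 0 r k <= m) = (k < count (leq^~ m) r).
Proof.
elim: r k => [|x r IHr] [|k] //= xr kr.
  case: (leqP x m) => //= mx; apply/esym/negbTE; rewrite -leqNgt leqn0.
  rewrite -[_ == 0]negbK -lt0n -has_count; apply/hasPn => y yr.
  by have /allP/(_ y yr) := order_path_min ltn_trans xr; rewrite -ltnNge; lia.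
rewrite IHr ?(path_sorted xr) //.
case: (leqP x m) => //= mx; rewrite add0n.
have -> : count (leq^~ m) r = 0; last by rewrite !ltn0.
apply/eqP; rewrite -[_ == 0]negbK -lt0n -has_count; apply/hasPn => y yr.
by have /allP/(_ y yr) := order_path_min ltn_trans xr; rewrite -ltnNge; lia.
Qed.

(** The two rows together contain exactly [m] entries at most [m], so it suffices that the top row
    has at least as many of them as the bottom row. *)
Lemma standard_ballot {n l1 l2} (s : rsyt n l1 l2) m : l2 <= l1 ->
  is_standard s -> m <= n -> (count (leq^~ m) (botrow s)).*2 <= m.
Proof.
move=> l21 /forallP sS mn.
case/and5P: (rsytP s) => /eqP szt /eqP szb st sb sP.
have : count (leq^~ m) (toprow s) + count (leq^~ m) (botrow s) = m.
  rewrite -count_cat (seq.permP sP) -[in iota 1 n](subnKC mn) iotaD count_cat.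
  rewrite (_ : count _ (iota 1 m) = m).
    rewrite (_ : count _ _ = 0) ?addn0 //.
    apply/eqP; rewrite -[_ == 0]negbK -lt0n -has_count; apply/hasPn => y.
    by rewrite mem_iota -ltnNge; lia.
  rewrite -[RHS](size_iota 1); apply/eqP; rewrite -all_count; apply/allP => y.
  by rewrite mem_iota /=; lia.
suff : count (leq^~ m) (botrow s) <= count (leq^~ m) (toprow s) by lia.
have [-> //|c_gt0] := posnP (count (leq^~ m) (botrow s)).
have := count_size (leq^~ m) (botrow s); rewrite szb => c_le.
(* This is the column of the last bottom entry at most [m]; the entry above it is smaller, hence
   also at most [m]. *)
have c_lt : (count (leq^~ m) (botrow s)).-1 < l2 by lia.
have := @count_leq_sorted (botrow s) _ m sb; rewrite szb => /(_ _ c_lt).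
have := @count_leq_sorted (toprow s) _ m st; rewrite szt => /(_ _ (leq_trans c_lt l21)).
have := sS (Ordinal c_lt); rewrite /=; lia.
Qed.

Lemma standard_1_notin_bot {n l1 l2} (s : rsyt n l1 l2) : 0 < n -> l2 <= l1 ->
  is_standard s -> 1 \notin botrow s.
Proof.
move=> n0 l21 /(@standard_ballot _ _ _ s 1 l21)/(_ n0) h; apply/negP => s1.
have : 0 < count (leq^~ 1) (botrow s) by rewrite -has_count; apply/hasP; exists 1.
by lia.
Qed.

(** The entry [b] occurs only once in the bottom row, so the interchange alters a single term of the
    count. The sums on both sides avoid truncated subtraction. *)
Lemma interchanged_count_bot {n l1 l2} (s t : rsyt n l1 l2) a b p :
  interchanged s t a b ->
  count p (botrow t) + p b = count p (botrow s) + p a.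
Proof.
case=> _ bs _ ->.
set f := fun x => _.
rewrite (seq.permP (permEl (perm_sort _ _))).
have sP := perm_to_rem bs.
rewrite (seq.permP sP) (seq.permP (perm_map f sP)) /= /f eqxx.
rewrite (_ : map _ (rem b _) = rem b (botrow s)); first by lia.
rewrite -[RHS]map_id; apply/eq_in_map => x.
by rewrite mem_rem_uniq ?botrow_uniq // inE => /andP[/negbTE ->].
Qed.

(** * Cyclic moves of the second kind, with representatives in [[1, n]] *)

(** The integers [i] and [j] are parameters here so that they can be replaced by congruent ones. *)
Definition bar_move2_at {n l1 l2} (s t : rsyt n l1 l2) (i j : int) : Prop :=
  (let d := ov n (j - i) in
    interchanged s t (ov n j) (ov n i) /\
    [/\ ov n i <> ov n (j + 1) /\ odd d,
        ov n (i + 1) \in toprow s /\ ov n (j - 1) \in botrow s,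
        ov n (i - 1) \in toprow s \/ ov n (j + 1) \in botrow s,
        forall k : nat, (1 <= k <= (d - 3)./2)%N ->
          (k <= count [in cyc n (ov n (j - 1 - 2 * k%:Z)) (ov n (j - 2))]
                  (botrow s))%N &
        ov n j <> ov n (i + 1) ->
          count [in cyc n (ov n (i + 2)) (ov n (j - 2))] (botrow s)
          = ((d - 3)./2)%N])%R.

Lemma bar_move2_at_mod {n l1 l2} (s t : rsyt n l1 l2) (i j i' j' : int) :
  (i = i' %[mod n])%Z -> (j = j' %[mod n])%Z ->
  bar_move2_at s t i j -> bar_move2_at s t i' j'.
Proof.
move=> ii' jj'.
have ovi c : ov n (i + c)%R = ov n (i' + c)%R.
  by apply: ov_mod; rewrite -modzDml ii' modzDml.
have ovj c : ov n (j + c)%R = ov n (j' + c)%R.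
  by apply: ov_mod; rewrite -modzDml jj' modzDml.
have ovji : ov n (j - i)%R = ov n (j' - i')%R.
  apply: ov_mod; rewrite -modzDml jj' modzDml -modzDmr.
  by rewrite -(modzNm i) ii' modzNm modzDmr.
rewrite /bar_move2_at ovji (ov_mod _ _ _ ii') (ov_mod _ _ _ jj') !ovi !ovj.
case=> st [d1 d2 d3 d4 d5]; split=> //; split=> // k.
by rewrite -[(j' - 1 - _)%R]addrA -(ovj (- 1 - _)%R) addrA; apply: d4.
Qed.

Lemma bar_move2P {n l1 l2} (s t : rsyt n l1 l2) : 0 < n ->
  bar_move2 s t <->
  exists i j : nat, [/\ 0 < i <= n, 0 < j <= n & bar_move2_at s t i%:Z j%:Z].
Proof.
move=> n0; split=> [[i [j ij]]|[i [j [_ _ ij]]]]; last by exists (Posz i), (Posz j).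
exists (ov n i), (ov n j); split; rewrite ?ov_range //.
by apply: bar_move2_at_mod ij; rewrite ovK.
Qed.

(** For [1 < i < j <= n] every residue that occurs is already in [[1, n]], except [j + 1] when
    [j = n]. *)
Lemma bar_move2_atP {n l1 l2} (s t : rsyt n l1 l2) (i j : nat) :
  1 < i < j -> j <= n -> (1 \notin botrow s) ->
  bar_move2_at s t i%:Z j%:Z <->
  interchanged s t j i /\
    [/\ (1 < i < j)%N /\ (j <= n)%N /\ odd (j - i),
        i.+1 \in toprow s /\ j.-1 \in botrow s,
        i.-1 \in toprow s \/ j.+1 \in botrow s,
        forall k : nat, (1 <= k <= (j - i - 3)./2)%N ->
          (k <= count (fun a => j - 1 - 2 * k <= a <= j - 2)%N (botrow s))%N &
        j <> i.+1 ->
          count (fun a => i + 2 <= a <= j - 2)%N (botrow s)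
          = ((j - i - 3)./2)%N].
Proof.
move=> ij jn s1.
have ovn (k : int) (m : nat) : k = Posz m -> 0 < m <= n -> ov n k = m.
  by move=> -> /ov_small.
rewrite /bar_move2_at (ovn (Posz i) i) ?(ovn (Posz j) j); try lia.
rewrite (ovn (j%:Z - i%:Z)%R (j - i)); try lia.
rewrite (ovn (i%:Z + 1)%R i.+1); try lia.
rewrite (ovn (i%:Z - 1)%R i.-1); try lia.
rewrite (ovn (j%:Z - 1)%R j.-1); try lia.
have ij1 : i <> ov n (j%:Z + 1)%R.
  have [jn'|jn'] := ltnP j n; first by rewrite ov_succ; lia.
  by rewrite (_ : j = n) ?ovDn ?(ovn 1%R 1); lia.
(* For [j = n] the left side asks for [1] and the right side for [n + 1] in the bottom row; both are
   false, which is the convention in condition (c). *)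
have j1E : (ov n (j%:Z + 1)%R \in botrow s) = (j.+1 \in botrow s).
  have [jn'|jn'] := ltnP j n; first by rewrite ov_succ; lia.
  rewrite (_ : j = n) ?ovDn ?(ovn 1%R 1); try lia.
  by rewrite (negbTE s1); apply/esym/negbTE/negP => /botrow_range; lia.
have countd (k : nat) : 1 <= k <= (j - i - 3)./2 ->
    count [in cyc n (ov n (j%:Z - 1 - 2 * k%:Z)%R) (ov n (j%:Z - 2)%R)] (botrow s)
    = count (fun a => j - 1 - 2 * k <= a <= j - 2) (botrow s).
  move=> kP; apply: eq_count => x.
  rewrite (ovn (j%:Z - 1 - 2 * k%:Z)%R (j - 1 - 2 * k)); try lia.
  by rewrite (ovn (j%:Z - 2)%R (j - 2)); try lia; rewrite /= mem_cyc; lia.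
(* Parity and [j <> i + 1] give [j - i >= 3], so the interval is at worst empty; for [j - i = 2] the
   cyclic interval would wrap around. *)
have counte : odd (j - i) -> j <> i.+1 ->
    count [in cyc n (ov n (i%:Z + 2)%R) (ov n (j%:Z - 2)%R)] (botrow s)
    = count (fun a => i + 2 <= a <= j - 2) (botrow s).
  move=> oij neij; apply: eq_count => x.
  rewrite (ovn (i%:Z + 2)%R (i + 2)); try lia.
  by rewrite (ovn (j%:Z - 2)%R (j - 2)); try lia; rewrite /= mem_cyc; lia.
rewrite j1E; split=> -[st [d1 d2 d3 d4 d5]]; split=> //.
- have oij : odd (j - i) by case: d1.
  by split=> // [k kP|jneq]; rewrite -?countd -?counte //; [apply: d4|apply: d5].
- have oij : odd (j - i) by case: d1 => _ [].
  by split=> // [k kP|jneq]; rewrite ?countd ?counte //; [apply: d4|apply: d5].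
Qed.

(* Suppose [j < i]. The ballot condition for [t] at [j] gives at most
   [(j - 4) / 2] bottom entries of [s] in [1, j - 2], whereas the interval
   condition with [k = (j - 2) / 2], which does not wrap around, asks for at
   least [k]. *)
Lemma bar_move2_at_lt {n l1 l2} (s t : rsyt n l1 l2) (i j : nat) :
  l2 <= l1 -> is_standard s -> is_standard t -> 0 < i <= n -> 0 < j <= n ->
  bar_move2_at s t i%:Z j%:Z -> 1 < i < j.
Proof.
move=> l21 sS tS iP jP [st [[_ d1] [d2 d2'] _ d4 _]].
have n_gt0 : 0 < n by lia.
have s1 := standard_1_notin_bot s n_gt0 l21 sS.
have t1 := standard_1_notin_bot t n_gt0 l21 tS.
have cP p := interchanged_count_bot s t _ _ p st.
case: (st) => js is_ _ tE; rewrite !ov_small // in js is_ cP d2' tE.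
(* The entry [i] is in the bottom row of [s] and [j] in that of [t], so standardness of the two
   tableaux excludes the value [1] for both. *)
have j_bot : j \in botrow t.
  rewrite tE mem_sort; apply/mapP; exists i; rewrite ?eqxx //.
have j1 : j != 1 by apply: contraNneq t1 => <-.
have i1 : i != 1 by apply: contraNneq s1 => <-.
have ij : i != j.
  by apply: contraTneq isT => eij; case: (top_bot_disjoint s _ js); rewrite -eij.
have [/=|ji] := ltnP i j; first by lia.
have jE : ov n (j%:Z - 1)%R = j.-1 by rewrite -predn_int ?ov_small; lia.
rewrite jE in d2'.
have {jE} dE : ov n (j%:Z - i%:Z)%R = n - (i - j).
  by rewrite -ovDn (_ : _ + _ = Posz (n - (i - j)))%R ?ov_small; lia.
rewrite dE in d1 d4.
have := standard_ballot t j l21 tS; rewrite (andP jP).2 => /(_ isT) tj.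
have := cP (leq^~ j); rewrite leqnn leqNgt ltn_neqAle ji eq_sym ij /= addn0.
move=> {}cP; rewrite cP in tj.
(* The bottom entry [j - 1] of [s] is counted only on the right. With [tj] this also forces
   [j >= 4]. *)
have cE : count (leq^~ j.-2) (botrow s) < count (leq^~ j) (botrow s).
  have sP := perm_to_rem d2'.
  rewrite !(seq.permP sP) /= leq_pred.
  have -> : (j.-1 <= j.-2) = false by lia.
  by rewrite ltnS; apply: sub_count => x /=; lia.
(* This [k] is admissible: [k >= 1] as [j >= 4], and [k <= (d - 3)./2] because
   [d = n - (i - j) >= j], where the oddness of [d] settles the case [d = j]. The interval then
   starts at [1] or [2]. *)
have := d4 (j - 2)./2.
have -> : ov n (j%:Z - 2)%R = j - 2 by rewrite (_ : _ - 2 = Posz (j - 2))%R ?ov_small; lia.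
rewrite (_ : ov n _ = j - 1 - 2 * (j - 2)./2); last first.
  by rewrite (_ : _ - _ = Posz (j - 1 - 2 * (j - 2)./2))%R ?ov_small; lia.
have : count [in cyc n (j - 1 - 2 * (j - 2)./2) (j - 2)] (botrow s)
       <= count (leq^~ j.-2) (botrow s).
  by apply: sub_count => x /=; rewrite mem_cyc; lia.
lia.
Qed.

(** * Cyclic and linear moves between standard tableaux *)

(** The only move that wraps around has [i = n], and it would need [1] in the bottom row of [s]. *)
Lemma bar_move1_standard {n l1 l2} (s t : rsyt n l1 l2) :
  1 < n -> l2 <= l1 -> is_standard s -> bar_move1 s t <-> move1 s t.
Proof.
move=> n_gt1 l21 sS; have s1 := standard_1_notin_bot s (ltnW n_gt1) l21 sS.
split=> [[i]|[i iP st]]; last first.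
  by exists (Posz i); rewrite ov_small ?ov_succ //; lia.
have /andP[i1 i_n] := ov_range n i (ltnW n_gt1).
rewrite (ov_mod n (i + 1)%R ((ov n i)%:Z + 1)%R); last first.
  by rewrite -[RHS]modzDml ovK ?modzDml //; lia.
move: (ov n i) i1 i_n => {}i i1 i_n st.
have [i_lt|n_le] := ltnP i n.
  by exists i; [lia|rewrite ov_succ ?i1 // in st].
case: st => _; rewrite (_ : i = n) ?ovDn ?(ov_small n 1) ?(negbTE s1); lia.
Qed.

Lemma bar_move2_standard {n l1 l2} (s t : rsyt n l1 l2) :
  1 < n -> l2 <= l1 -> is_standard s -> is_standard t ->
  bar_move2 s t <-> move2 s t.
Proof.
move=> n_gt1 l21 sS tS; have s1 := standard_1_notin_bot s (ltnW n_gt1) l21 sS.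
rewrite bar_move2P ?(ltnW n_gt1) //.
split=> [[i [j [iP jP ij]]]|[i [j mij]]]; exists i, j.
  apply/bar_move2_atP => //; last by case/andP: jP.
  exact: bar_move2_at_lt ij.
have [_ [[ij [jn _]] _ _ _ _]] := mij.
by split; [lia|lia|apply/bar_move2_atP].
Qed.

(** * Descents lost under a move, and the parabolic restriction *)

Lemma move1_des {n l1 l2} (s t : rsyt n l1 l2) :
  move1 s t -> ~ (des s `<=` des t)%classic.
Proof.
case=> i iP [is_ js tE bE] /(_ i) [].
  by split; [split=> //; [lia|rewrite ov_succ //; lia]|rewrite /=; lia].
case=> _ it _ _; apply: (top_bot_disjoint t _ it).
by rewrite bE mem_sort; apply/mapP; exists i.+1; rewrite ?eqxx.
Qed.

(** Condition (c) provides the lost descent: [i - 1] if [i - 1] is in the top row of [s], as [i]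
    moves up, and [j] if [j + 1] is in the bottom row, as [j] moves down. *)
Lemma move2_des {n l1 l2} (s t : rsyt n l1 l2) :
  move2 s t -> ~ (des s `<=` des t)%classic.
Proof.
case=> i [j [[js is_ tE bE] [[ij [jn _]] _ c _ _]]] sub.
case: c => [i1s|j1s].
  have [] := sub i.-1.
    split; last by rewrite /=; lia.
    by split=> //; [lia|rewrite ov_succ ?prednK //; lia].
  case=> _ _; rewrite ov_succ; last by lia.
  rewrite prednK; last by lia.
  move=> it _; apply: (top_bot_disjoint t _ _ it).
  by rewrite tE mem_sort; apply/mapP; exists j; rewrite ?eqxx.
have jn1 := botrow_range s _ j1s.
have [] := sub j.
  by split; [split=> //; [lia|rewrite ov_succ //; lia]|rewrite /=; lia].
case=> _ jt _ _; apply: (top_bot_disjoint t _ jt).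
by rewrite bE mem_sort; apply/mapP; exists i; rewrite ?eqxx.
Qed.

Lemma restrict_tau_des n l1 l2 (v : rsyt n l1 l2) :
  restrict_tau (G := Gamma_bar n l1 l2) [set i | (1 <= i <= n.-1)%N]%classic v
  = des v.
Proof.
apply/seteqP; split=> i /=.
  by case=> iv /= i_n; split=> //= ni; move: i_n; rewrite ni; lia.
by case=> iv /= i_n; split=> //=; case: iv => /= + _ _; move/eqP: i_n; lia.
Qed.

(** * The weight function and its transport along isomorphisms *)

Lemma given_by_moves_Gamma n l1 l2 : 1 < n -> l2 <= l1 ->
  given_by_moves (G := Gamma n l1 l2) id.
Proof.
move=> n_gt1 l21; split=> [s|s t]; first exact: restrict_tau_des.
have [sS tS] := (svalP s, svalP t).
have m1 := bar_move1_standard (sval s) (sval t) n_gt1 l21 sS.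
have m2 := bar_move2_standard (sval s) (sval t) n_gt1 l21 sS tS.
rewrite /= /restrict_wt !restrict_tau_des /= /bar_wt.
split=> [st|st|n1 n2].
- by rewrite (asboolF (move1_des _ _ st)) asboolT //; left; apply/m1.
- by rewrite (asboolF (move2_des _ _ st)) asboolT //; right; apply/m2.
(* Without a move both branches of the restricted weight are [0]. *)
- by rewrite (@asboolF (_ \/ _)) ?if_same // => -[/m1|/m2].
Qed.

Lemma given_by_moves_iso n l1 l2 (I : set nat) (G G' : lgraph I)
    (f : syt n l1 l2 -> vert G) (phi : vert G -> vert G') :
  lgraph_iso phi -> given_by_moves f -> given_by_moves (phi \o f).
Proof.
case=> _ wphi tphi [tf wf].
by split=> [s|s t]; [rewrite /= tphi tf|rewrite /= wphi; apply: wf].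
Qed.

Theorem theorem7p8 (n lam1 lam2 : nat) (hn : 3 <= n)
    (hlam : [/\ lam1 + lam2 = n, lam2 <= lam1 & 1 <= lam2]) :
  given_by_moves (G := Gamma n lam1 lam2) id /\
  (forall (C : {set 'S_n}) (phi : syt n lam1 lam2 -> vert (cell_graph C)),
     is_left_cell C ->
     (forall w, w \in C -> rs_shape w = [:: lam1; lam2]) ->
     lgraph_iso (G := Gamma n lam1 lam2) phi ->
     given_by_moves phi).
Proof.
have [_ l21 _] := hlam.
have Gam := given_by_moves_Gamma n lam1 lam2 (ltnW hn) l21.
split=> // C phi _ _ iso.
exact: given_by_moves_iso iso Gam.
Qed.
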